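(* Let $f(n)=|S_n(3\mathrm{-}\bar{1}\mathrm{-}42,\,3\mathrm{-}\bar{1}\mathrm{-}24)|$ for $n\ge1$ and $f(0)=1$. Let $F_n$ be the Fibonacci numbers with $F_0=F_1=1$, and define, for $n\ge k+2$, \[ a(n,k)=\sum_{\substack{n_1,\dots,n_{k+1}\ge0\\ n_1+\dots+n_{k+1}=n-k-2}} F_{n_1}F_{n_2}\cdots F_{n_{k+1}}, \] with $a(n,k)=0$ otherwise. Let $X=(f(0),f(1),f(2),\dots)^T$, $F=(1,F_0,F_1,F_2,\dots)^T$ and $\mathbf{A}=(a(n,k))_{n,k\ge0}$ (strictly lower triangular with zero main diagonal). Then $X=(\mathbf{I}-\mathbf{A})^{-1}F$, where $\mathbf{I}$ is the infinite identity matrix.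
   Context: $S_n(\pi,\pi')$ is the set of permutations in $\mathfrak{S}_n$ avoiding both patterns. $\sigma$ contains $3\mathrm{-}\bar{1}\mathrm{-}42$ if there are $i<j<n$ with $\sigma_{j+1}<\sigma_i<\sigma_j$ and no $k$ with $i<k<j$, $\sigma_k<\sigma_{j+1}$. $\sigma$ contains $3\mathrm{-}\bar{1}\mathrm{-}24$ if there are $i<j<n$ with $\sigma_j<\sigma_i<\sigma_{j+1}$ and no $k$ with $i<k<j$, $\sigma_k<\sigma_j$. *)

(* Defs.v *)
From mathcomp Require Import all_boot all_order all_algebra all_fingroup.
From mathcomp Require Import all_classical.

Set Implicit Arguments.
Unset Strict Implicit.
Unset Printing Implicit Defensive.

Import GRing.Theory.

Local Open Scope ring_scope.

(* Positions and values of s : 'S_n are 0-based; the position j + 1 is a third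
   index j' constrained to be the successor of j, so that j' : 'I_n forces
   j + 1 to be a legal position. *)
Definition contains_3_b1_42 (n : nat) (s : 'S_n) : bool :=
  [exists i : 'I_n, exists j : 'I_n, exists j' : 'I_n,
    [&& (i < j)%N, j' == j.+1 :> nat, (s j' < s i)%N, (s i < s j)%N
      & ~~ [exists k : 'I_n, [&& (i < k)%N, (k < j)%N & (s k < s j')%N]]]].

Definition contains_3_b1_24 (n : nat) (s : 'S_n) : bool :=
  [exists i : 'I_n, exists j : 'I_n, exists j' : 'I_n,
    [&& (i < j)%N, j' == j.+1 :> nat, (s j < s i)%N, (s i < s j')%N
      & ~~ [exists k : 'I_n, [&& (i < k)%N, (k < j)%N & (s k < s j)%N]]]].

Definition avoiders (n : nat) : {set 'S_n} :=
  [set s : 'S_n | ~~ contains_3_b1_42 s & ~~ contains_3_b1_24 s].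

Definition f (n : nat) : nat := if n is 0 then 1%N else #|avoiders n|.

(* Indexed so that fib 0 = fib 1 = 1. *)
Fixpoint fib (n : nat) : nat :=
  if n is m.+1 then (if m is p.+1 then fib m + fib p else 1)%N else 1%N.

(* The (k+1)-tuples of naturals are functions into 'I_n.+1; the bound is
   harmless because the parts sum to n - k - 2 <= n. *)
Definition a (n k : nat) : nat :=
  if (k + 2 <= n)%N then
    (\sum_(p : {ffun 'I_k.+1 -> 'I_n.+1} | \sum_(i < k.+1) p i == n - k - 2)
       \prod_(i < k.+1) fib (p i))%N
  else 0%N.

Definition infmx (R : Type) : Type := nat -> nat -> R.
Definition infcol (R : Type) : Type := nat -> R.

Definition row_finite (R : pzRingType) (M : infmx R) : Prop :=
  forall n, finite_set [set j | M n j != 0]%classic.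

(* These are sums over all j : nat; they are genuine finite sums as soon as
   the left factor M is row-finite (the library sum is 0 on infinite
   support). *)
Definition infmx_mul (R : pzRingType) (M N : infmx R) : infmx R :=
  fun n k => \sum_(j \in [set: nat]%classic) (M n j * N j k).
Definition infmx_mulcol (R : pzRingType) (M : infmx R) (v : infcol R) : infcol R :=
  fun n => \sum_(j \in [set: nat]%classic) (M n j * v j).

Definition infmx1 {R : pzRingType} : infmx R := fun n k => (n == k)%:R.
Definition infmx_sub (R : pzRingType) (M N : infmx R) : infmx R := fun n k => M n k - N n k.

(* N is a two-sided inverse of M in the ring of row-finite matrices. *)
Definition infmx_inverse (R : pzRingType) (M N : infmx R) : Prop :=
  [/\ row_finite M, row_finite N,
      infmx_mul M N = infmx1 & infmx_mul N M = infmx1].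

Definition A : infmx int := fun n k => (a n k)%:Z.
Definition X : infcol int := fun n => (f n)%:Z.
Definition F : infcol int := fun n => if n is m.+1 then (fib m)%:Z else 1.

(* Main.v *)
Require Import Defs.
From mathcomp Require Import all_boot all_order all_algebra all_fingroup.
From mathcomp Require Import all_classical.
From mathcomp Require Import zify ring.

(** Prepending a letter [a] to a permutation [s] gives an avoider iff [s] is an
avoider and [a] is either the minimum or larger than the first two letters of
[s]. Let [H n v] count the avoiders of length [n] that do not start with their
minimum and have [v] letters above the first one, and [P n u] those with [u]
letters above the maximum of the first two. With generating functions
[H(x, y)] and [P(x, y)] ([n >= 1]),
  [H = x (y P(x, y) - P(x, 1)) / (y - 1)],
  [P = H + x (x f(x y) + H) + x],   [P(x, 1) = f(x) - 1].
The kernel of this equation vanishes at [y = phi := 1 / (1 - x - x^2)], which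
gives [f(x) = 1 + x phi + x^2 phi f(x phi)], i.e. [(I - A) X = F]. *)

Set Implicit Arguments.
Unset Strict Implicit.
Unset Printing Implicit Defensive.

Import GRing.Theory.

Local Open Scope ring_scope.

(** * Avoiders by their first letters *)

(** The patterns differ only by swapping the last two letters, and in each the required [k] lies
    below the smaller one; hence one condition symmetric in [j] and [j']. *)
Lemma avoidersP n (s : 'S_n) :
  reflect (forall i j j' : 'I_n, (i < j)%N -> j' = j.+1 :> nat ->
      (s j' < s i < s j)%N || (s j < s i < s j')%N ->
      exists k : 'I_n, [/\ (i < k)%N, (k < j)%N, (s k < s j)%N & (s k < s j')%N])
    (s \in avoiders n).
Proof.
rewrite inE; apply: (iffP andP) => [[no42 no24] i j j' ij jj'|av].
  case/orP => /andP[lt1 lt2].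
    have : [exists k : 'I_n, [&& (i < k)%N, (k < j)%N & (s k < s j')%N]].
      apply: contraNT no42 => nk; apply/existsP; exists i; apply/existsP; exists j.
      by apply/existsP; exists j'; rewrite ij jj' eqxx lt1 lt2.
    case/existsP=> k /and3P[ik kj skj]; exists k; split => //; lia.
  have : [exists k : 'I_n, [&& (i < k)%N, (k < j)%N & (s k < s j)%N]].
    apply: contraNT no24 => nk; apply/existsP; exists i; apply/existsP; exists j.
    by apply/existsP; exists j'; rewrite ij jj' eqxx lt1 lt2.
  case/existsP=> k /and3P[ik kj skj]; exists k; split => //; lia.
split; apply/existsP => -[i /existsP[j /existsP[j' /and5P[ij /eqP jj' lt1 lt2 /negP]]]];
  apply; have [|k [ik kj k1 k2]] := av i j j' ij jj'; rewrite ?lt1 ?lt2 ?orbT //;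
  by apply/existsP; exists k; rewrite ik kj.
Qed.

(** A maximum over positions, so that length 1 needs no separate case. *)
Definition top2 n (s : 'S_n) : nat := (\max_(j < n | (j < 2)%N) s j)%N.

Lemma top2_ltP n (s : 'S_n.+1) (m : nat) :
  reflect (forall j : 'I_n.+1, (j < 2)%N -> (s j < m)%N) (top2 s < m)%N.
Proof.
apply: (iffP idP) => [lt j j2|lt].
  exact: leq_ltn_trans (leq_bigmax_cond (F := fun j => nat_of_ord (s j)) _ j2) lt.
have [j j2 ->] : {j : 'I_n.+1 | (j < 2)%N & top2 s = s j}.
  by rewrite /top2; apply: eq_bigmax_cond; apply/card_gt0P; exists ord0.
exact: lt.
Qed.

Lemma top2_ltn n (s : 'S_n.+1) : (top2 s < n.+1)%N.
Proof. exact/top2_ltP. Qed.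

Lemma ltn_lift n (a : 'I_n.+1) (x y : 'I_n) : (lift a x < lift a y)%N = (x < y)%N.
Proof. rewrite /= /bump; case: leqP; case: leqP => /=; lia. Qed.

Lemma lift_ltn n (a : 'I_n.+1) (x : 'I_n) : (lift a x < a)%N = (x < a)%N.
Proof. rewrite /= /bump; case: leqP => /=; lia. Qed.

Lemma ltn_lift_pivot n (a : 'I_n.+1) (x : 'I_n) : (a < lift a x)%N = (a <= x)%N.
Proof. rewrite /= /bump; case: leqP => /=; lia. Qed.

Lemma cons_avoiders n (a : 'I_n.+2) (s : 'S_n.+1) :
  (lift_perm ord0 a s \in avoiders n.+2) =
  (s \in avoiders n.+1) && ((a == ord0) || (top2 s < a)%N).
Proof.
set t := lift_perm ord0 a s.
have t0 : t ord0 = a by exact: lift_perm_id.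
have tl k : t (lift ord0 k) = lift a (s k) by exact: lift_perm_lift.
apply/avoidersP/andP => [av|[/avoidersP av /orP ha]].
  split.
    apply/avoidersP => i j j' ij jj' btw.
    have [|||k] := av (lift ord0 i) (lift ord0 j) (lift ord0 j').
    - by rewrite ltn_lift.
    - by rewrite !lift0 jj'.
    - by rewrite !tl !ltn_lift.
    case: (unliftP ord0 k) => [k' ->|-> []//].
    by rewrite !tl !ltn_lift; exists k'.
  case: eqP => //= /eqP a0; apply/top2_ltP.
  have a_gt0 : (0 < a)%N by rewrite lt0n.
  (* Otherwise the first descent of [t] to a letter below [a] would be an
     occurrence with [i = 0]. *)
  have s0 : (s ord0 < a)%N.
    rewrite ltnNge; apply/negP => as0.
    have ex_small : exists k, (k < n.+1)%N && (s (inord k) < a)%N.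
      by exists (s^-1 ord0)%g; rewrite ltn_ord inord_val permKV.
    case: (ex_minnP ex_small) => -[|k] /andP[kn sk] kmin.
      by move: sk; rewrite (_ : inord 0 = ord0) ?ltnNge ?as0 //; apply/val_inj; rewrite /= inordK.
    have := av ord0 (lift ord0 (inord k)) (lift ord0 (inord k.+1)).
    rewrite !lift0 !inordK ?(ltnW kn) // => /(_ isT erefl).
    rewrite !t0 !tl !lift_ltn !ltn_lift_pivot sk /=.
    have -> : (a <= s (inord k))%N.
      rewrite leqNgt; apply/negP => sk'.
      by have := kmin k; rewrite (ltnW kn) sk' => /(_ isT); rewrite ltnn.
    case=> // k'; case: (unliftP ord0 k') => [k2 ->|-> []//].
    rewrite !lift0 !tl !ltn_lift => -[_ k2k _ small].
    have := kmin k2; rewrite ltn_ord inord_val (ltn_trans small sk) => /(_ isT).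
    by rewrite ltnNge ltnW.
  move=> j; case: (unliftP ord0 j) => [j' ->|-> //].
  rewrite lift0 => j'2; rewrite ltnNge; apply/negP => asj.
  (* Positions 0, 1, 2 of [t] now form an occurrence, and no position lies strictly between 0 and
     1. *)
  have := av ord0 (lift ord0 ord0) (lift ord0 (lift ord0 j')).
  rewrite !lift0 => /(_ isT).
  have -> : j' = 0%N :> nat by move: j'2; case: (nat_of_ord j').
  move=> /(_ erefl); rewrite t0 !tl !lift_ltn !ltn_lift_pivot s0 asj /=.
  by rewrite orbT => /(_ isT)[k []]; case: (unliftP ord0 k) => [k' ->|->] //; rewrite lift0.
move=> i j j'.
case: (unliftP ord0 j) => [{}j ->|-> //]; case: (unliftP ord0 j') => [{}j' ->|-> //].
rewrite !lift0; case: (unliftP ord0 i) => [{}i ->|->].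
  rewrite !lift0 !tl !ltn_lift => ij [jj'] btw; have [k [ik kj k1 k2]] := av i j j' ij jj' btw.
  by exists (lift ord0 k); rewrite !tl !lift0 !ltn_lift.
move=> _ [jj']; rewrite t0 !tl !lift_ltn !ltn_lift_pivot => btw.
case: ha => [/eqP a0|/top2_ltP ha]; first by move: btw; rewrite a0 /=; lia.
have s0 := ha ord0 isT.
have j_gt0 : (0 < j)%N.
  rewrite lt0n; apply/eqP => j0; have := ha j; have := ha j'; rewrite jj' j0 => /(_ isT) + /(_ isT).
  lia.
(* If the first letter of [s] is below both [s j] and [s j'], it is the witness. Otherwise it lies
   strictly between them, and avoidance in [s] supplies one. *)
have [lt0|ge0] := boolP ((s ord0 < s j)%N && (s ord0 < s j')%N).
  by exists (lift ord0 ord0); rewrite !tl !lift0 !ltn_lift; case/andP: lt0.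
have sj0 : s ord0 != s j :> nat.
  by rewrite (inj_eq val_inj) (inj_eq perm_inj); apply/eqP => e; rewrite -e in j_gt0.
have sj'0 : s ord0 != s j' :> nat.
  by rewrite (inj_eq val_inj) (inj_eq perm_inj); apply/eqP => e; rewrite -e in jj'.
have [|k [ik kj k1 k2]] := av ord0 j j' j_gt0 jj'; first by lia.
by exists (lift ord0 k); rewrite !tl !lift0 !ltn_lift.
Qed.

Lemma cons_perm_bij n :
  bijective (fun p : 'I_n.+1 * 'S_n => lift_perm ord0 p.1 p.2).
Proof.
apply: inj_card_bij => [[a s] [b t] /= e|]; last first.
  by rewrite card_prod card_ord !card_Sn factS.
have eab : a = b by have := congr1 (fun u : 'S__ => u ord0) e; rewrite !lift_perm_id.
rewrite -eab in e *; congr pair; apply/permP => k; apply: (@lift_inj _ a).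
by have := congr1 (fun u : 'S__ => u (lift ord0 k)) e; rewrite !lift_perm_lift.
Qed.

Lemma sum_cons_perm n (V : nmodType) (C : pred 'S_n.+1) (G : 'S_n.+1 -> V) :
  \sum_(t | C t) G t =
  \sum_s \sum_(a | C (lift_perm ord0 a s)) G (lift_perm ord0 a s).
Proof.
rewrite (reindex _ (onW_bij _ (cons_perm_bij n))) /=.
by rewrite [RHS](exchange_big_dep xpredT) //= pair_big_dep.
Qed.

Lemma avoiders1 (s : 'S_1) : s \in avoiders 1.
Proof. by apply/avoidersP => i j; rewrite (ord1 i) (ord1 j). Qed.

Lemma card_avoiders n : #|avoiders n| = f n.
Proof.
case: n => //=; have -> : avoiders 0 = [set: 'S_0].
  by apply/setP => s; rewrite finset.in_setT; apply/avoidersP => -[].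
by rewrite cardsT card_Sn.
Qed.

Lemma top2_lift_perm n (a : 'I_n.+2) (s : 'S_n.+1) :
  top2 (lift_perm ord0 a s) = maxn a (lift a (s ord0)).
Proof.
rewrite /top2 big_mkcond 2!big_ord_recl big1 //= maxn0.
by rewrite lift_perm_id lift_perm_lift.
Qed.

(** * Linear statistics of avoiders *)

Section Statistics.

Variable V : zmodType.
Implicit Types w : nat -> V.

(** Permutations here have [n.+1] letters, so [n - v] counts the letters above [v]. An arbitrary
    weight [w] replaces [y ^ u], which later allows [y = phi]; [sum_top2] plays [P] and
    [sum_first_gt0] plays [H]. *)
Definition sum_top2 n w := \sum_(s in avoiders n.+1) w (n - top2 s)%N.
Definition sum_first n w := \sum_(s in avoiders n.+1) w (n - s ord0)%N.
Definition sum_first_gt0 n w :=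
  \sum_(s in avoiders n.+1 | s ord0 != ord0) w (n - s ord0)%N.

Lemma sum_top2D n w1 w2 :
  sum_top2 n (fun u => w1 u + w2 u) = sum_top2 n w1 + sum_top2 n w2.
Proof. exact: big_split. Qed.

Lemma sum_first_gt0_0 w : sum_first_gt0 0 w = 0.
Proof. by apply: big1 => s /andP[_]; rewrite (ord1 (s ord0)). Qed.

Lemma sum_top2_0 w : sum_top2 0 w = w 0%N.
Proof.
rewrite /sum_top2; under eq_bigr do rewrite sub0n.
rewrite (eq_bigl predT) => [|s]; last exact: avoiders1.
by rewrite sumr_const card_Sn.
Qed.

(** Deleting a leading minimum is a bijection onto the avoiders of length [n]. *)
Lemma sum_first_eq0 n w :
  \sum_(s in avoiders n.+1 | s ord0 == ord0) w (n - s ord0)%N = w n *+ f n.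
Proof.
under eq_bigr => s /andP[_ /eqP ->] do rewrite subn0.
case: n => [|n].
  rewrite (eq_bigl predT) => [|s]; first by rewrite sumr_const card_Sn.
  by rewrite avoiders1 (ord1 (s ord0)).
rewrite -card_avoiders -sumr_const sum_cons_perm [RHS]big_mkcond /=.
apply: eq_bigr => s _; case: ifP => av; last first.
  by apply: big_pred0 => a; rewrite cons_avoiders av.
rewrite (big_pred1 ord0) // => a.
by rewrite cons_avoiders av lift_perm_id /=; case: (a == ord0); rewrite ?andbF.
Qed.

Lemma sum_firstE n w : sum_first n w = w n *+ f n + sum_first_gt0 n w.
Proof.
by rewrite /sum_first (bigID (fun s : 'S__ => s ord0 == ord0)) /= sum_first_eq0.
Qed.

(** The equation for [H]: a non-minimal first letter ranges over the values above [top2 s], and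
    [(y ^ u.+1 - 1) / (y - 1)] becomes a sum of weights. *)
Lemma sum_first_gt0S n w :
  sum_first_gt0 n.+1 w = sum_top2 n (fun u => \sum_(j < u.+1) w j).
Proof.
rewrite /sum_first_gt0 sum_cons_perm [RHS]big_mkcond /=; apply: eq_bigr => s _.
case: ifP => av; last first.
  by apply: big_pred0 => a; rewrite cons_avoiders av.
have le := top2_ltn s.
rewrite (big_ord_widen n.+2) ?ltnS ?leq_subr //; last by lia.
(* After reversal the index is the number of letters above the first one. *)
rewrite (reindex_inj rev_ord_inj) /=; apply: eq_big => [a|a _].
  rewrite cons_avoiders av lift_perm_id -val_eqE /=.
  have := ltn_ord a; lia.
by rewrite lift_perm_id /= subSS subKn // -ltnS.
Qed.

(** The equation for [P]: a non-minimal first letter exceeds the second, while after a leading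
    minimum the second letter is the maximum of the two. *)
Lemma sum_top2S n w : sum_top2 n.+1 w = sum_first_gt0 n.+1 w + sum_first n w.
Proof.
rewrite /sum_top2 (bigID (fun s : 'S__ => s ord0 != ord0)) /=; congr (_ + _).
  rewrite /sum_first_gt0 [LHS]sum_cons_perm [RHS]sum_cons_perm.
  apply: eq_bigr => s _; apply: eq_bigr => a.
  rewrite cons_avoiders top2_lift_perm lift_perm_id => /andP[/andP[_ /orP[->//|]]].
  move=> /top2_ltP/(_ ord0 isT) lt _; congr (w (_ - _)%N).
  by apply/maxn_idPl; rewrite leqNgt ltn_lift_pivot -ltnNge.
rewrite sum_cons_perm /sum_first [RHS]big_mkcond /=; apply: eq_bigr => s _.
case: ifP => av; last first.
  by apply: big_pred0 => a; rewrite cons_avoiders av.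
rewrite (big_pred1 ord0) => [|a]; last first.
  by rewrite cons_avoiders av lift_perm_id negbK /=; case: (a == ord0); rewrite ?andbF.
by rewrite top2_lift_perm /= max0n subSS.
Qed.

End Statistics.

Lemma sum_top2_1 n : sum_top2 n (fun=> 1) = (f n.+1)%:R :> int.
Proof. by rewrite -card_avoiders -sumr_const. Qed.

(** * Powers of the Fibonacci series *)

(* The series [phi = 1 / (1 - x - x^2)] truncated at degree [N]. *)
Definition fib_poly (N : nat) : {poly int} := \poly_(i < N.+1) (fib i)%:R.

(** The last term is the truncation error, invisible in degrees up to [N]. *)
Lemma fib_polyE N : fib_poly N = 1 + 'X * fib_poly N + 'X^2 * fib_poly N
  - 'X^(N.+1) * ((fib N.+1)%:R + (fib N)%:R * 'X).
Proof.
rewrite /fib_poly; elim: N => [|N IH].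
  rewrite poly_def big_ord1 /= expr0 scale1r; ring.
have -> : \poly_(i < N.+2) (fib i)%:R =
    \poly_(i < N.+1) (fib i)%:R + (fib N.+1)%:R * 'X^(N.+1) :> {poly int}.
  by rewrite !poly_def big_ord_recr /= -mul_polyC polyC_natr.
rewrite {1}IH (_ : fib N.+2 = fib N.+1 + fib N)%N // natrD !exprS; ring.
Qed.

Lemma coef_fib_poly_exp N u t : (t <= N)%N ->
  (fib_poly N ^+ u.+1)`_t = (fib_poly N ^+ u)`_t +
    (if t is t'.+1 then (fib_poly N ^+ u.+1)`_t' else 0) +
    (if t is t'.+2 then (fib_poly N ^+ u.+1)`_t' else 0).
Proof.
move=> tN; set p := fib_poly N ^+ u.
have E : fib_poly N ^+ u.+1 = p + 'X * fib_poly N ^+ u.+1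
    + 'X^2 * fib_poly N ^+ u.+1
    - 'X^(N.+1) * (((fib N.+1)%:R + (fib N)%:R * 'X) * p).
  by rewrite exprS -/p {1}fib_polyE; ring.
rewrite {1}E coefB !coefD coefXM !coefXnM (ltnS t N) tN subr0.
by case: t tN => [|[|t]] _; rewrite ?subSS ?subn0.
Qed.

Lemma coef_fib_poly_exp0 N u : (fib_poly N ^+ u)`_0 = 1.
Proof.
by elim: u => [|u IH]; rewrite ?expr0 ?coef1 // coef_fib_poly_exp // IH !addr0.
Qed.

(** Since [phi - 1 = (x + x^2) phi], the geometric sum gives [phi^u - 1 = (x + x^2) (phi + ... +
    phi^u)]. *)
Lemma coef_fib_poly_expS N u t : (t < N)%N ->
  (fib_poly N ^+ u)`_t.+1 = \sum_(j < u) (fib_poly N ^+ j.+1)`_t +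
    (if t is t'.+1 then \sum_(j < u) (fib_poly N ^+ j.+1)`_t' else 0).
Proof.
move=> tN; elim: u => [|u IH].
  by rewrite expr0 coef1 big_ord0 add0r; case: t tN => // t _; rewrite big_ord0.
rewrite coef_fib_poly_exp // IH; case: t {IH} tN => [|t] _.
  by rewrite !addr0 big_ord_recr.
by rewrite !big_ord_recr /=; ring.
Qed.

(** Expanding the product of truncated series gives a sum over functions into ['I_n.+1], as in [a];
    hence the truncation at [n]. *)
Lemma aE n k : (k + 2 <= n)%N -> (a n k)%:Z = (fib_poly n ^+ k.+1)`_(n - k - 2).
Proof.
move=> kn; rewrite /a kn.
have -> : fib_poly n ^+ k.+1 = \prod_(i < k.+1) fib_poly n.
  by rewrite prodr_const card_ord.
rewrite /fib_poly poly_def bigA_distr_bigA coef_sum -natz natr_sum big_mkcond /=.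
apply: eq_bigr => p _.
rewrite scaler_prod prodrXr coefZ coefXn -natr_prod eq_sym.
by case: eqP; rewrite ?mulr1 ?mulr0.
Qed.

(** * The kernel method and the recurrence for [f] *)

Section Recurrence.

Variable m : nat.

Let W t u := (fib_poly m.+1 ^+ u.+1)`_t.
Let P n t := sum_top2 n (W t).
(** At [y = phi], [P n] and [D n] list the coefficients of [phi P] and [x phi H] for length
    [n.+1]. *)
Let D n t := if t is t'.+1 then sum_first_gt0 n (W t') else 0.

(** The geometric sum for powers of [phi] matches the sum of weights in [sum_first_gt0S], so no
    division by [y - 1] occurs. *)
Lemma P_shift n t : (t <= m)%N -> P n t.+1 = D n.+1 t.+1 + D n.+1 t.
Proof.
move=> tm; rewrite /P /D /W.
case: t tm => [|t] tm; rewrite ?addr0 !sum_first_gt0S -?sum_top2D;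
  by apply: eq_bigr => s _; rewrite coef_fib_poly_expS // addr0.
Qed.

Lemma P_succ n t : P n.+1 t = D n.+1 t.+1 + D n t.+1 + W t n *+ f n.
Proof. by rewrite /P sum_top2S sum_firstE addrA addrAC. Qed.

(* The kernel method on coefficients: [W t u] is the coefficient of [x^t] in
   [phi ^+ u.+1], where [phi] is the root of the kernel. *)
Lemma P_invariant i : (i <= m)%N ->
  P i (m - i) + D i (m - i) = (fib m)%:R + \sum_(k < i) W (m - k.+1) k *+ f k.
Proof.
elim: i => [_|i IH im].
  rewrite big_ord0 subn0 addr0 /P sum_top2_0 /W expr1 coef_poly ltnS leqnSn.
  by rewrite /D; case: m => [|m']; rewrite ?sum_first_gt0_0 addr0.
rewrite big_ord_recr /= addrA -IH ?(ltnW im) // P_succ.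
(* With [t = m - i.+1], [P_succ] and [P_shift] produce the same [D i.+1] terms, at [t] and [t.+1],
   on both sides. *)
have -> : (m - i = (m - i.+1).+1)%N by lia.
by rewrite P_shift ?leq_subr //; ring.
Qed.

(** This is the invariant at [i = m]: there [D] vanishes, and the weight [W 0] is constantly 1, so
    [P m 0] counts avoiders. *)
Lemma f_recurrence :
  (f m.+1)%:Z = (fib m)%:Z + \sum_(k < m.+1) (a m.+1 k)%:Z * (f k)%:Z.
Proof.
have -> : \sum_(k < m.+1) (a m.+1 k)%:Z * (f k)%:Z = \sum_(k < m) W (m - k.+1) k *+ f k.
  rewrite big_ord_recr /= [X in _ + X * _](_ : _ = 0) ?mul0r ?addr0; last first.
    by rewrite /a ifF //; lia.
  apply: eq_bigr => k _; rewrite aE; last by have := ltn_ord k; lia.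
  by rewrite -[(f k)%:Z]natz mulr_natr /W; congr (_`_ _ *+ _); lia.
rewrite -![Posz _]natz -P_invariant // subnn /D addr0 /P -sum_top2_1.
by apply: eq_bigr => s _; rewrite /W coef_fib_poly_exp0.
Qed.

End Recurrence.

(** * Row-finite matrices *)

Section RowFinite.

Variable R : pzRingType.
Implicit Types M N : infmx R.

Lemma fsum_nat_ord (b : nat) (u : nat -> R) :
  (forall j, (b <= j)%N -> u j = 0) ->
  \sum_(j \in [set: nat]%classic) u j = \sum_(j < b) u j.
Proof.
move=> u0; rewrite -(big_mkord xpredT u).
rewrite (fsbigE (index_iota 0 b)) ?iota_uniq //; last first.
  by move=> j _; rewrite mem_index_iota /= -leqNgt => /u0.
by apply: eq_bigl => j; rewrite in_setT.
Qed.

Lemma row_finite_bound M n :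
  row_finite M -> exists b, forall j, (b <= j)%N -> M n j = 0.
Proof.
move=> /(_ n) /finite_seqP[E ME].
exists (\max_(j <- E) j).+1 => j jb; apply/eqP/negPn/negP => Mj.
have : [set j | M n j != 0]%classic j by [].
rewrite ME /= => jE.
have : (j <= \max_(i <- E) i)%N by apply: leq_bigmax_seq.
by rewrite leqNgt jb.
Qed.

Lemma infmx_mul_ord M N n k (b : nat) : (forall j, (b <= j)%N -> M n j = 0) ->
  infmx_mul M N n k = \sum_(j < b) M n j * N j k.
Proof. by move=> M0; apply: fsum_nat_ord => j /M0 ->; rewrite mul0r. Qed.

(** Row [n] of [M] meets only the first [b] rows of [N], which share a support bound [d]; the sums
    are then finite and can be exchanged. *)
Lemma infmx_mulA M N (L : infmx R) : row_finite M -> row_finite N ->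
  infmx_mul (infmx_mul M N) L = infmx_mul M (infmx_mul N L).
Proof.
move=> fM fN; apply/funext => n; apply/funext => k.
have [b Mb] := row_finite_bound n fM.
have /choice[c Nc] : forall j, exists c, forall l, (c <= l)%N -> N j l = 0.
  by move=> j; exact: row_finite_bound.
pose d := (\max_(j < b) c j)%N.
have Nd (j : 'I_b) l : (d <= l)%N -> N j l = 0.
  by move=> dl; apply/Nc/(leq_trans _ dl)/(leq_bigmax (F := fun j : 'I_b => c j)).
have MNE l := infmx_mul_ord N l Mb.
rewrite (infmx_mul_ord _ _ Mb) (@infmx_mul_ord _ _ _ _ d); last first.
  by move=> l dl; rewrite MNE big1 // => j _; rewrite Nd // mulr0.
under eq_bigr do rewrite MNE mulr_suml.
rewrite exchange_big /=; apply: eq_bigr => j _.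
rewrite (infmx_mul_ord _ _ (Nd j)) mulr_sumr.
by apply: eq_bigr => l _; rewrite mulrA.
Qed.

Lemma infmx_mul1l M : infmx_mul infmx1 M = M.
Proof.
apply/funext => n; apply/funext => k; rewrite (@infmx_mul_ord _ _ _ _ n.+1).
  rewrite big_ord_recr /= big1 ?add0r ?/infmx1 ?eqxx ?mul1r // => j _.
  by rewrite gtn_eqF // mul0r.
by move=> j nj; rewrite /infmx1 ltn_eqF.
Qed.

Lemma row_finite1 : row_finite (infmx1 : infmx R).
Proof.
move=> n; apply: (@sub_finite_set _ _ [set n]%classic); last exact: finite_set1.
by move=> j /=; rewrite /infmx1; have [->|_] := eqVneq n j; rewrite ?eqxx.
Qed.

Lemma infmx_mul1r M : row_finite M -> infmx_mul M infmx1 = M.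
Proof.
move=> fM; apply/funext => n; apply/funext => k.
have [b Mb] := row_finite_bound n fM.
rewrite (@infmx_mul_ord _ _ _ _ (maxn b k.+1)); last first.
  by move=> j; rewrite geq_max => /andP[/Mb].
have kb : (k < maxn b k.+1)%N by rewrite leq_max ltnSn orbT.
rewrite (bigD1 (Ordinal kb)) //= /infmx1 eqxx mulr1 big1 ?addr0 // => j.
by rewrite -val_eqE /= => /negPf ->; rewrite mulr0.
Qed.

Definition lower M := forall n k, (n < k)%N -> M n k = 0.

Lemma lower_row_finite M : lower M -> row_finite M.
Proof.
move=> lM n; apply: (@sub_finite_set _ _ `I_n.+1); last exact: finite_II.
by move=> j /= /eqP Mj; rewrite ltnS leqNgt; apply/negP => /lM.
Qed.

(** * Neumann series of strictly lower triangular matrices *)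

Section Neumann.

Variable M : infmx R.
Hypothesis strict_M : forall n k, (n <= k)%N -> M n k = 0.

Definition infmx_pow i : infmx R := iter i (infmx_mul M) infmx1.

Lemma infmx_powS i n k :
  infmx_pow i.+1 n k = \sum_(j < n) M n j * infmx_pow i j k.
Proof. by apply: infmx_mul_ord => j /strict_M. Qed.

Lemma infmx_pow_eq0 i n k : (n < k + i)%N -> infmx_pow i n k = 0.
Proof.
elim: i n k => [|i IH] n k; first by rewrite addn0 => nk; rewrite /= /infmx1 ltn_eqF.
move=> nki; rewrite infmx_powS big1 // => j _; rewrite IH ?mulr0 //.
by rewrite -ltnS -addnS; apply: leq_ltn_trans nki.
Qed.

(** Row [n] of the [i]-th power vanishes for [i > n], so this finite sum is the full series. *)
Definition neumann : infmx R := fun n k => \sum_(i < n.+1) infmx_pow i n k.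

Lemma neumannE b n k : (n < b)%N -> neumann n k = \sum_(i < b) infmx_pow i n k.
Proof.
move=> nb; rewrite /neumann (big_ord_widen _ (fun i => infmx_pow i n k) nb).
rewrite [RHS](bigID (fun i : 'I_b => (i < n.+1)%N)) /= [X in _ + X]big1 ?addr0 // => i.
by rewrite -leqNgt => ni; rewrite infmx_pow_eq0 // (leq_trans ni) ?leq_addl.
Qed.

Lemma neumann_lower : lower neumann.
Proof.
move=> n k nk; apply: big1 => i _; apply: infmx_pow_eq0.
by rewrite (leq_trans nk) ?leq_addr.
Qed.

Lemma neumann_diag n : neumann n n = 1.
Proof.
rewrite /neumann big_ord_recl big1 => [|i _].
  by rewrite addr0 /= /infmx1 eqxx.
by rewrite infmx_pow_eq0 // lift0 addnS ltnS leq_addr.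
Qed.

Lemma sub1_lower : lower (infmx_sub infmx1 M).
Proof. by move=> n k nk; rewrite /infmx_sub /infmx1 ltn_eqF // strict_M ?subr0 // ltnW. Qed.

Lemma mul_sub1_neumann : infmx_mul (infmx_sub infmx1 M) neumann = infmx1.
Proof.
apply/funext => n; apply/funext => k.
rewrite (@infmx_mul_ord _ _ _ _ n.+1); last by move=> j /sub1_lower.
rewrite big_ord_recr /= {2}/infmx_sub /infmx1 eqxx strict_M // subr0 mul1r.
under eq_bigr => j _.
  rewrite /infmx_sub /infmx1 gtn_eqF // sub0r mulNr (@neumannE n.+1) ?mulr_sumr; last first.
    by rewrite ltnS ltnW.
  over.
rewrite sumrN exchange_big /=.
under eq_bigr do rewrite -infmx_powS.
(* The cut-off [n.+2] for row [n], against [n.+1] for the rows above it, makes the sums telescope to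
   the zeroth power. *)
by rewrite (@neumannE n.+2) // [X in _ + X]big_ord_recl addrCA addNr addr0.
Qed.

End Neumann.

(* The Neumann series of a unitriangular matrix is unitriangular, hence has
   itself a right inverse, and this makes it a left inverse as well. *)
Lemma infmx_inverse_neumann M : (forall n k, (n <= k)%N -> M n k = 0) ->
  infmx_inverse (infmx_sub infmx1 M) (neumann M).
Proof.
move=> sM; set U := infmx_sub _ _; set B := neumann M.
have UB : infmx_mul U B = infmx1 := mul_sub1_neumann sM.
have fU : row_finite U := lower_row_finite (sub1_lower sM).
have fB : row_finite B := lower_row_finite (neumann_lower sM).
split=> //; pose M' := infmx_sub infmx1 B.
have sM' n k : (n <= k)%N -> M' n k = 0.
  rewrite leq_eqVlt /M' /infmx_sub /infmx1 => /predU1P[->|nk].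
    by rewrite eqxx [B _ _]neumann_diag ?subrr.
  by rewrite ltn_eqF // [B _ _]neumann_lower ?subrr.
have BE : infmx_sub infmx1 M' = B.
  by apply/funext => n; apply/funext => k; rewrite /infmx_sub subKr.
have := mul_sub1_neumann sM'; rewrite BE => BB'.
suff -> : U = neumann M' by [].
by rewrite -[RHS]infmx_mul1l -UB infmx_mulA // BB' infmx_mul1r.
Qed.

Lemma infmx_inverse_unique M N N' :
  infmx_inverse M N -> infmx_inverse M N' -> N = N'.
Proof.
move=> [fM fN _ NM] [_ fN' MN' _].
by rewrite -[LHS]infmx_mul1r // -MN' -infmx_mulA // NM infmx_mul1l.
Qed.

(** Viewing a column as a matrix with all columns equal to it lets associativity apply to
    vectors. *)
Lemma infmx_mulcolE M (v : infcol R) n :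
  infmx_mulcol M v n = infmx_mul M (fun j _ => v j) n 0%N.
Proof. by []. Qed.

Lemma infmx_inverse_mulcol M N (u v : infcol R) :
  infmx_inverse M N -> infmx_mulcol M u = v -> u = infmx_mulcol N v.
Proof.
move=> [fM fN _ NM] <-; apply/funext => n.
have -> : u n = infmx_mul infmx1 (fun j _ => u j) n 0%N by rewrite infmx_mul1l.
by rewrite -NM infmx_mulA.
Qed.

End RowFinite.

(** * The matrix identity for [X] *)

Lemma A_strict n k : (n <= k)%N -> A n k = 0.
Proof. by move=> nk; rewrite /A /a ifF //; lia. Qed.

Theorem mainTheorem10 :
  (forall n k : nat, (n <= k)%N -> A n k = 0) /\
  exists2 B : infmx int,
    unique (infmx_inverse (infmx_sub infmx1 A)) B & X = infmx_mulcol B F.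
Proof.
split; first exact: A_strict.
have inv := infmx_inverse_neumann A_strict.
exists (neumann A); first by split=> // B; exact: infmx_inverse_unique.
(* It remains to prove [(I - A) X = F]: row 0 reads [f 0 = 1], and row [m.+1] is [f_recurrence]. *)
apply: (infmx_inverse_mulcol inv); apply/funext => n.
rewrite infmx_mulcolE (@infmx_mul_ord _ _ _ _ _ n.+1); last first.
  by move=> j nj; apply: sub1_lower nj; exact: A_strict.
rewrite big_ord_recr /= {2}/infmx_sub /infmx1 eqxx A_strict // subr0 mul1r.
under eq_bigr => j _ do rewrite /infmx_sub /infmx1 gtn_eqF // sub0r mulNr.
rewrite sumrN addrC; case: n => [|m]; first by rewrite big_ord0 subr0.
by rewrite /X f_recurrence /F addrK.
Qed.
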